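(* Let $B>0$, $\mathcal Y=[-B,B]$, let $d,n\ge1$ be integers, let $q>1+\sqrt{\frac{\lfloor\log_2d\rfloor}{4n}\wedge1}$, and consider the loss $\ell(y,y')=|y-y'|^q$. For any input space $\mathcal X$ containing at least $\lfloor\log_2(2d)\rfloor$ points, there exists a set $\mathcal G$ of $d$ prediction functions such that: for any estimator $\hat g$ (with training set size $n$) there exists a probability distribution on the data space $\mathcal X\times[-B,B]$ for which $$\mathbb ER(\hat g)-\min_{g\in\mathcal G}R(g)\ge\Big(\frac q{90(q-1)}\vee e^{-1}\Big)B^q\Big(\frac{\lfloor\log_2|\mathcal G|\rfloor}{n+1}\wedge1\Big).$$
   Context: A prediction function is a measurable map $\mathcal X\to\mathcal Y$. For a distribution $P$ on $\mathcal X\times\mathcal Y$, $R(g)=\mathbb E_{(X,Y)\sim P}\ell[Y,g(X)]$. An estimator maps a training set $Z_1^n\in(\mathcal X\times\mathcal Y)^n$ to a prediction function (measurably), and $\mathbb ER(\hat g)$ is its expected risk when $Z_1^n\sim P^{\otimes n}$. $a\wedge b=\min(a,b)$, $a\vee b=\max(a,b)$ and $\lfloor x\rfloor$ is the largest integer $k\le x$.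
   Formalization: The input space is required to contain ⌊log₂(2d)⌋ points pairwise separated by measurable sets, not merely distinct points; under a trivial σ-algebra all prediction functions are constant and the claimed bound fails (q=2, d=2^100, n=1000). *)

(* Defs.v *)
From HB Require Import structures.
From mathcomp Require Import all_boot all_order all_algebra.
From mathcomp Require Import all_classical all_reals all_analysis.

Set Implicit Arguments.
Unset Strict Implicit.
Unset Printing Implicit Defensive.

Import Order.TTheory GRing.Theory Num.Theory.
Import numFieldNormedType.Exports.
Local Open Scope classical_set_scope.
Local Open Scope ring_scope.

(* The output space [-B, B], with the trace of the Borel sigma-algebra. *)
Definition outcome (R : realType) (B : {posnum R}) : Type :=
  {y : R | - B%:num <= y <= B%:num}.

Section outcome_structures.
Context (R : realType) (B : {posnum R}).

HB.instance Definition _ := Choice.on (outcome B).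

Let outcome0 : - B%:num <= (0 : R) <= B%:num.
Proof. by rewrite oppr_le0 !ge0. Qed.

HB.instance Definition _ :=
  isPointed.Build (outcome B) (exist _ (0 : R) outcome0).

Definition outcome_val (y : outcome B) : R := sval y.

HB.instance Definition _ :=
  Measurable.copy (outcome B) (g_sigma_algebra_preimageType outcome_val).

End outcome_structures.

Section product_law.
Context d (T : measurableType d) (R : realType).

Definition tuple_cons n (x : T * n.-tuple T) : n.+1.-tuple T :=
  [tuple of x.1 :: x.2].

Lemma measurable_tuple_cons n : measurable_fun setT (@tuple_cons n).
Proof. exact: measurable_cons. Qed.

HB.instance Definition _ n :=
  isMeasurableFun.Build _ _ _ _ (@tuple_cons n) (@measurable_tuple_cons n).

(* P^{\otimes n} on n-tuples, characterized by [product_law_box]. *)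
Fixpoint product_law (P : probability T R) n : probability (n.-tuple T) R :=
  if n is n'.+1 then
    distribution (P \x product_law P n')%E (@tuple_cons n')
  else \d_ [tuple].

Lemma product_law_box (P : probability T R) n (A : 'I_n -> set T) :
  (forall i, measurable (A i)) ->
  (product_law P n [set z | forall i, A i (tnth z i)] =
   \prod_(i < n) P (A i))%E.
Proof.
elim: n A => [|n IHn] A mA.
  rewrite big_ord0 /= diracE mem_set//= => -[]//.
have mbox : measurable [set z : n.-tuple T | forall i, A (lift ord0 i) (tnth z i)].
  rewrite [X in measurable X](_ : _ =
    \bigcap_(i in [set: 'I_n]) ((@tnth n T ^~ i) @^-1` A (lift ord0 i))).
    apply: fin_bigcap_measurable => // i _.
    by rewrite -[X in measurable X]setTI; exact: measurable_tnth.
  by apply/seteqP; split => z /= h; [move=> i _; exact: h|move=> i; exact: h].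
rewrite big_ord_recl -IHn// /= /distribution /pushforward /=.
rewrite -product_measure1E//; congr (_ _); apply/seteqP; split => -[x z] /= h.
  by split => [|i]; [exact: (h ord0)|have := h (lift ord0 i); rewrite tnthS].
move=> i; case: (unliftP ord0 i) => [j ->|->]; last exact: h.1.
by rewrite tnthS; exact: h.2.
Qed.

End product_law.

Section prediction.
Context d (X : measurableType d) (R : realType) (B : {posnum R}).
Local Open Scope ereal_scope.

Definition loss (q : R) (y y' : outcome B) : R :=
  (`|outcome_val y - outcome_val y'| `^ q)%R.

Definition risk (q : R) (P : probability (X * outcome B)%type R)
    (g : X -> outcome B) : \bar R :=
  'E_P[fun z => loss q z.2 (g z.1)].

(* Joint measurability makes each [ghat z] a prediction function and
   [z |-> risk q P (ghat z)] measurable. *)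
Definition estimator n (ghat : n.-tuple (X * outcome B) -> X -> outcome B) :=
  measurable_fun setT
    (fun zx : n.-tuple (X * outcome B) * X => ghat zx.1 zx.2).

Definition expected_risk n (q : R) (P : probability (X * outcome B)%type R)
    (ghat : n.-tuple (X * outcome B) -> X -> outcome B) : \bar R :=
  \int[product_law P n]_z risk q P (ghat z).

End prediction.

(* Points that no measurable set tells apart are one point for every
   prediction function, so only distinguishable points are counted (under a
   trivial sigma-algebra all prediction functions are constant). When
   singletons are measurable, any distinct points are distinguishable. *)
Definition has_points d (X : measurableType d) (N : nat) : Prop :=
  exists x : 'I_N -> X, forall i j, i != j ->
    exists2 A : set X, measurable A & A (x i) /\ ~ A (x j).

(* Main.v *)
Require Import Defs.
From HB Require Import structures.
From mathcomp Require Import all_boot all_order all_algebra.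
From mathcomp Require Import all_classical all_reals all_analysis.
From mathcomp Require Import measurable_realfun ring lra zify.

Set Implicit Arguments.
Unset Strict Implicit.
Unset Printing Implicit Defensive.

Import Order.TTheory GRing.Theory Num.Theory.
Import numFieldNormedType.Exports.
Local Open Scope classical_set_scope.
Local Open Scope ring_scope.

(* The lower bound is that of testing the vertices of a hypercube. With
   [m = floor (log2 d)], put mass [w] on each of [m] points and let the sign of
   the noisy label [Y = B] or [- B] at the [k]-th point have bias [xi] towards
   an unknown bit [s k]; the remaining mass sits on one noiseless point. The best
   prediction at the [k]-th point is [y0] or [- y0] according to [s k], and by
   convexity of the loss no prediction is good for both values of [s k]. Hence,
   on average over [s], the excess risk is at least
   [m w S (B^q - noisy_risk y0)], where [S] bounds from below the overlap of the
   laws of the samples of two neighbouring vertices.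
   Noiseless labels ([xi = 1], [w = 1 / max (m, n + 1)]) give the constant
   [1 / e]: there [S] is at least the probability of never seeing the [k]-th
   point. The constant [q / (90 (q - 1))] only matters for [q] close to [1], and
   then [xi = 7 (q - 1) / 5] and [w = 1 / (4 n (q - 1)^2)] do, the hypothesis on
   [q] being [m w < 1]. *)

(** * Laws with finitely many atoms, and samples drawn from them *)

Section finite_laws.
Context d (T : measurableType d) (R : realType).
Local Open Scope ereal_scope.

(** A finite sum of weighted Dirac masses. Only its integrals are recorded, as risks are
    integrals. *)
Lemma exists_finite_law (J : finType) (p : J -> R) (a : J -> T) :
  (forall j, 0 <= p j)%R -> (\sum_j p j = 1)%R ->
  exists P : probability T R, forall f : T -> \bar R,
    measurable_fun setT f -> (forall x, 0 <= f x) ->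
    \int[P]_x f x = \sum_j (p j)%:E * f (a j).
Proof.
move=> p0 p1.
have [j0 _|J0] := pickP [pred _ : J | true]; last first.
  by move: p1; rewrite big_pred0// => /eqP; rewrite eq_sym oner_eq0.
pose m_ k : {measure set T -> \bar R} :=
  mscale (NngNum (p0 (nth j0 (enum J) k))) \d_(a (nth j0 (enum J) k)).
have sumE (F : J -> \bar R) : \sum_(k < #|J|) F (nth j0 (enum J) k) = \sum_j F j.
  rewrite -(big_mkord xpredT (fun k => F (nth j0 (enum J) k))) cardE.
  by rewrite -(big_nth j0 xpredT) big_enum.
pose mu : {measure set T -> \bar R} := msum m_ #|J|.
have mu1 : mu setT = 1.
  rewrite /mu /= /msum /= /m_ /mscale /=.
  under eq_bigr do rewrite diracT mule1.
  by rewrite (sumE (EFin \o p)) sumEFin p1.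
pose P := HB.pack_for (probability T R) (Measure.sort mu)
  (Measure_isProbability.Build _ _ _ mu mu1).
exists P => f mf f0.
etransitivity.
  exact: (@ge0_integral_measure_sum _ _ _ m_ _ measurableT f (fun x _ => f0 x) mf #|J|).
rewrite -(sumE (fun j => (p j)%:E * f (a j))); apply: eq_bigr => k _.
by rewrite ge0_integral_mscale//= integral_dirac// diracT mul1e.
Qed.

Lemma sum_tuple_cons (V : nmodType) (J : finType) n (F : n.+1.-tuple J -> V) :
  (\sum_z F z = \sum_j \sum_(z : n.-tuple J) F [tuple of j :: z])%R.
Proof.
rewrite pair_bigA/= (reindex (fun x : J * n.-tuple J => [tuple of x.1 :: x.2])).
  by [].
exists (fun z => (thead z, [tuple of behead z])) => [[j z]|z] _ /=.
  by rewrite theadE; congr pair; apply: val_inj.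
by rewrite -tuple_eta.
Qed.

(** Induction on [n], Tonelli's theorem splitting off the first observation. *)
Lemma integral_product_law (J : finType) (p : J -> R) (a : J -> T)
    (P : probability T R) :
  (forall j, 0 <= p j)%R ->
  (forall f : T -> \bar R, measurable_fun setT f -> (forall x, 0 <= f x) ->
    \int[P]_x f x = \sum_j (p j)%:E * f (a j)) ->
  forall n (f : n.-tuple T -> \bar R), measurable_fun setT f ->
  (forall z, 0 <= f z) ->
  \int[product_law P n]_z f z =
  \sum_(z : n.-tuple J) (\prod_(j <- z) p j)%:E * f (map_tuple a z).
Proof.
move=> p0 PE; elim=> [|n IHn] f mf f0.
  rewrite /= integral_dirac// diracT mul1e (big_pred1 [tuple]).
    by rewrite big_nil mul1e; congr f; apply: val_inj.
  by case=> -[]// sz; apply/esym/eqP/val_inj.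
have mcons := @measurable_tuple_cons _ T n.
have mfc : measurable_fun setT (f \o @tuple_cons _ T n).
  exact: measurableT_comp.
have fc0 x : 0 <= (f \o @tuple_cons _ T n) x by exact: f0.
rewrite /= ge0_integral_distribution// fubini_tonelli1//.
rewrite PE//; last 2 first.
- exact: measurable_fun_fubini_tonelli_F.
- by move=> x; apply: integral_ge0 => y _; exact: f0.
rewrite sum_tuple_cons; apply: eq_bigr => j _; rewrite /fubini_F /= IHn//; last first.
  exact: (measurableT_comp mfc (pair1_measurable (a j))).
rewrite ge0_sume_distrr; last first.
  by move=> z _; rewrite mule_ge0// lee_fin prodr_ge0.
apply: eq_bigr => z _; rewrite big_cons EFinM muleA.
by congr (_ * f _); apply: val_inj.
Qed.

End finite_laws.

(** Intersecting the separating sets gives measurable sets [C i] that contain [x i] and no other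
    [x j]. A function of the finite pattern of memberships in the [C i] is measurable whatever its
    values. *)
Lemma measurable_interpolation d d' (X : measurableType d)
    (Y : measurableType d') N (x : 'I_N.+1 -> X) (v : 'I_N.+1 -> Y) :
  (forall i j, i != j -> exists2 A : set X, measurable A & A (x i) /\ ~ A (x j)) ->
  exists g : {mfun X >-> Y}, forall i, g (x i) = v i.
Proof.
move=> sep.
have /choice[A Asep] (ij : 'I_N.+1 * 'I_N.+1) : exists A : set X,
    [/\ measurable A, A (x ij.1) & (ij.1 != ij.2 -> ~ A (x ij.2))].
  have [->|/sep[A mA [Ai Aj]]] := eqVneq ij.1 ij.2; last by exists A.
  by exists setT.
pose C i := \bigcap_(j in [set: 'I_N.+1]) A (i, j).
have mC i : measurable (C i).
  by apply: fin_bigcap_measurable => // j _; have [] := Asep (i, j).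
have Cx i j : (x i \in C j) = (i == j).
  apply/idP/eqP => [|->]; last first.
    by apply/mem_set => k _; have [] := Asep (j, k).
  move=> /set_mem /(_ i Logic.I); have [_ _ /= ji Aji] := Asep (j, i).
  by apply/eqP/negPn/negP => ij; apply: ji Aji; rewrite eq_sym.
pose h y : {ffun 'I_N.+1 -> bool} := [ffun i => y \in C i].
(* A point may lie in several [C i] or in none, and the choice made there is arbitrary; [x i] itself
   lies in [C i] alone. *)
pose val (b : {ffun 'I_N.+1 -> bool}) := oapp v (v ord0) [pick i | b i].
have mg : measurable_fun setT (val \o h).
  move=> _ U _; rewrite setTI (_ : _ @^-1` _ =
    \bigcup_(b in [set b | U (val b)]) \bigcap_(i in [set: 'I_N.+1])
      (if b i then C i else ~` C i)).
    apply: fin_bigcup_measurable => // b _; apply: fin_bigcap_measurable => // i _.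
    by case: ifP => // _; exact: measurableC.
  apply/seteqP; split=> y /=.
    move=> Uy; exists (h y) => //= i _; rewrite ffunE.
    by case: ifPn => [/set_mem|yC /mem_set]; rewrite ?(negbTE yC).
  move=> [b Ub Cb]; rewrite (_ : h y = b)//; apply/ffunP => i; rewrite ffunE.
  have := Cb i Logic.I; case: ifP => _ => [/mem_set ->|Cy] //.
  by apply/negbTE/negP => /set_mem.
pose mh := isMeasurableFun.Build _ _ _ _ _ mg.
exists (HB.pack_for {mfun X >-> Y} (val \o h) mh) => i /=.
rewrite /val; case: pickP => [j|/(_ i)]; rewrite ffunE Cx; first by move=> /eqP->.
by rewrite eqxx.
Qed.

Section outcomes.
Context (R : realType) (B : {posnum R}).

Lemma measurable_outcome_val : measurable_fun setT (@outcome_val R B).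
Proof. by move=> _ U mU; exists U. Qed.

Definition outcome_of (y : R) (yB : - B%:num <= y <= B%:num) : outcome B :=
  exist _ y yB.

Lemma outcome_val_itv (y : outcome B) : - B%:num <= outcome_val y <= B%:num.
Proof. by case: y. Qed.

End outcomes.

(** * Averaging over the vertices of a hypercube *)

Section hypercube.
Context (R : realFieldType) (m : nat).
Implicit Types (k : 'I_m) (s : {ffun 'I_m -> bool}).

Definition flip k s : {ffun 'I_m -> bool} := [ffun l => (l == k) (+) s l].

Lemma flipK k : involutive (flip k).
Proof. by move=> s; apply/ffunP => l; rewrite !ffunE addbA addbb. Qed.

(* Assouad's lemma, by pairing [s] with [flip k s] for every [k]. *)
Lemma assouad (Z : finType) (p : {ffun 'I_m -> bool} -> Z -> R)
    (e : Z -> 'I_m -> bool -> R) (c S : R) :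
  (forall s z, 0 <= p s z) -> 0 <= c ->
  (forall z k b, 0 <= e z k b) ->
  (forall z k, 2 * c <= e z k true + e z k false) ->
  (forall s k, S <= \sum_z Num.min (p s z) (p (flip k s) z)) ->
  exists s, m%:R * c * S <= \sum_z p s z * \sum_k e z k (s k).
Proof.
move=> p0 c0 e0 e2 pS; apply/existsP; apply: contraT; rewrite negb_exists.
move=> /forallP lt.
pose F k s := \sum_z p s z * e z k (s k).
have Fflip k s : 2 * (c * S) <= F k s + F k (flip k s).
  rewrite /F -big_split/= mulrA.
  apply: (@le_trans _ _ (2 * c * \sum_z Num.min (p s z) (p (flip k s) z))).
    by rewrite ler_wpM2l ?mulr_ge0.
  rewrite mulr_sumr; apply: ler_sum => z _; rewrite ffunE eqxx addTb.
  set a := p s z; set b := p _ z.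
  have : 2 * c <= e z k (s k) + e z k (~~ s k) by case: (s k); rewrite //= addrC.
  move=> /(ler_wpM2r (_ : 0 <= Num.min a b)) -/(_ _)/le_trans; apply.
    by rewrite le_min !p0.
  by rewrite mulrDl lerD// mulrC ler_wpM2r// ge_min lexx ?orbT.
have sumF k : \sum_(s : {ffun 'I_m -> bool}) c * S <= \sum_s F k s.
  rewrite -(ler_pM2l (ltr0Sn _ 1)) [leRHS]mulr_natl mulr2n.
  rewrite [X in _ <= _ + X](reindex_inj (inv_inj (flipK k)))/= -big_split/=.
  by rewrite mulr_sumr; exact: ler_sum.
(* If the mean over all vertices reaches the bound, they cannot all stay strictly below it. *)
suff : \sum_(s : {ffun 'I_m -> bool}) m%:R * c * S <=
       \sum_s \sum_z p s z * \sum_k e z k (s k).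
  rewrite leNgt => /negP[]; apply: ltr_sum => [|s _]; last by rewrite ltNge.
  by apply/hasP; exists [ffun=> true]; rewrite // mem_index_enum.
under [leRHS]eq_bigr => s _.
  under eq_bigr do rewrite mulr_sumr.
  rewrite exchange_big/=; over.
rewrite exchange_big/=.
apply: le_trans (ler_sum _ (fun k _ => sumF k)).
rewrite [leRHS]sumr_const card_ord -[leRHS]mulr_natl mulr_sumr.
by under [leRHS]eq_bigr do rewrite mulrA.
Qed.

End hypercube.

(** * Overlap of product laws *)

Section product_sums.
Context (R : realFieldType) (J : finType).
Implicit Types (h p r : J -> R).

Lemma sum_prod_tuple n h :
  \sum_(z : n.-tuple J) \prod_(j <- z) h j = (\sum_j h j) ^+ n.
Proof.
elim: n => [|n IHn].
  by rewrite (big_pred1 [tuple]) ?big_nil// => -[[]// sz]; apply/esym/eqP/val_inj.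
rewrite sum_tuple_cons exprS mulr_suml; apply: eq_bigr => j _.
by rewrite -IHn mulr_sumr; apply: eq_bigr => z _; rewrite big_cons.
Qed.

(** The product of a common minorant is below both products, and its sum over the samples
    factorises. *)
Lemma sum_min_prod_ge n h p r :
  (forall j, 0 <= h j) -> (forall j, h j <= p j) -> (forall j, h j <= r j) ->
  (\sum_j h j) ^+ n <=
  \sum_(z : n.-tuple J) Num.min (\prod_(j <- z) p j) (\prod_(j <- z) r j).
Proof.
move=> h0 hp hr; rewrite -sum_prod_tuple; apply: ler_sum => z _.
by rewrite le_min !ler_prod// => j _; rewrite h0 ?hp ?hr.
Qed.

(* A linearised form of Le Cam's bound of the affinity by the Hellinger one:
   [2 h <= 4 min(p, r) + max(p, r) / 4] by AM-GM. *)
Lemma sum_min_prod_ge_affinity n h p r :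
  (forall j, 0 <= h j) -> (forall j, 0 <= p j) -> (forall j, 0 <= r j) ->
  (forall j, h j ^+ 2 <= p j * r j) -> \sum_j p j = 1 -> \sum_j r j = 1 ->
  (\sum_j h j) ^+ n / 2 - 8^-1 <=
  \sum_(z : n.-tuple J) Num.min (\prod_(j <- z) p j) (\prod_(j <- z) r j).
Proof.
move=> h0 p0 r0 hpr p1 r1.
have : \sum_(z : n.-tuple J) (\prod_(j <- z) h j / 2 -
    (\prod_(j <- z) p j + \prod_(j <- z) r j) / 16) = (\sum_j h j) ^+ n / 2 - 8^-1.
  rewrite sumrB -!mulr_suml big_split/= !sum_prod_tuple p1 r1 expr1n.
  by congr (_ - _); lra.
move=> <-; apply: ler_sum => z _.
have : (\prod_(j <- z) h j) ^+ 2 <= (\prod_(j <- z) p j) * (\prod_(j <- z) r j).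
  by rewrite -prodrXl -big_split/= ler_prod// => j _; rewrite exprn_ge0//= hpr.
have : 0 <= \prod_(j <- z) p j by rewrite prodr_ge0.
have : 0 <= \prod_(j <- z) r j by rewrite prodr_ge0.
have : 0 <= \prod_(j <- z) h j by rewrite prodr_ge0.
move: (\prod_(j <- z) h j) (\prod_(j <- z) p j) (\prod_(j <- z) r j) => H P Q.
move=> H0 Q0 P0 HPQ.
suff amgm a b : 0 <= a -> 0 <= b -> H ^+ 2 <= a * b -> H / 2 - (a + b) / 16 <= a.
  by rewrite le_min amgm//= [P + Q]addrC amgm// mulrC.
move=> a0 b0 Hab; suff : 2 * H <= 4 * a + b / 4 by lra.
rewrite -(@ler_pXn2r _ 2)// ?nnegrE; [|lra|lra].
(* The squares of [4 * a + b / 4] and [4 * a - b / 4] differ by [4 * a * b]. *)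
by have := sqr_ge0 (4 * a - b / 4); nra.
Qed.

End product_sums.

(** * The power loss and its risk under a noisy label *)

Section power_loss.
Context (R : realType).
Implicit Types (q x y B xi : R).

(** Differentiability settles the points other than [0]; at [0] the function is squeezed below the
    norm, as [1 <= q]. *)
Lemma continuous_powR_norm q : 1 <= q -> continuous (fun x : R => `|x| `^ q).
Proof.
move=> q1 x; have [->|x0] := eqVneq x 0; last first.
  apply: (@continuous_comp _ _ _ (fun x : R => `|x|) (@powR R ^~ q)).
    exact: norm_continuous.
  apply/differentiable_continuous/derivable1_diffP/derivable_powR.
  by rewrite in_itv/= andbT normr_gt0.
have q0 : q != 0 by rewrite gt_eqF// (lt_le_trans _ q1).
suff lim0 : `|y| `^ q @[y --> (0 : R)] --> (0 : R).
  by rewrite /continuous_at normr0 powR0.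
have norm0 : `|y| @[y --> (0 : R)] --> (0 : R).
  by rewrite -[X in _ --> X](normr0 R); exact: norm_continuous.
apply: (squeeze_cvgr _ (cvg_cst 0) norm0).
near=> y; rewrite powR_ge0 /=.
have [->|y0] := eqVneq y 0; first by rewrite normr0 powR0.
apply: ge1r_powR => //; rewrite normr_gt0 y0 /=.
near: y; exact: (@nbhs0_le R R 1 ltr01).
Unshelve. all: by end_near. Qed.

(** Convexity at [B], the midpoint of [B - y] and [B + y]. *)
Lemma powR_midpoint q B y : 1 <= q -> - B <= y <= B ->
  2 * B `^ q <= `|B - y| `^ q + `|- B - y| `^ q.
Proof.
move=> q1 /andP[By yB].
rewrite ger0_norm ?subr_ge0// -normrN opprB opprK.
rewrite ger0_norm; last by rewrite -lerBlDr sub0r.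
have half01 : 0 <= (2^-1 : R) <= 1 by rewrite invr_ge0 ler0n invf_le1 ?ler1n.
have := @convex_powR R q q1 (Itv01 (andP half01).1 (andP half01).2) (B - y) (y + B).
rewrite !inE /= !in_itv/= !andbT subr_ge0 -lerBlDr sub0r => /(_ yB By).
rewrite convRE [X in X `^ _ <= _]convRE /= /unstable.onem.
rewrite (_ : 2^-1 * _ + _ = B); [|lra].
move=> h; lra.
Qed.

(** Inside the interval, Young's inequality with exponents [1 / x] and [1 / (1 - x)], the second
    factor being [1]. *)
Lemma powR2_le1D x : 0 <= x <= 1 -> 2 `^ x <= 1 + x :> R.
Proof.
move=> /andP[]; rewrite le_eqVlt => /predU1P[<-|x0]; first by rewrite powRr0 addr0.
rewrite le_eqVlt => /predU1P[->|x1]; first by rewrite powRr1.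
have x1' : 0 < 1 - x by rewrite subr_gt0.
have := @conjugate_powR R (2 `^ x) 1 x^-1 (1 - x)^-1.
rewrite powR_ge0 ler01 !invr_gt0 x0 x1' !invrK mulr1 powR1 -powRrM.
rewrite mulfV ?gt_eqF// powRr1//.
rewrite mul1r addrC subrK => /(_ isT isT isT isT erefl) h; lra.
Qed.

(** Conditional risk of predicting [y] when the label is [B] with probability [(1 + xi) / 2] and
    [- B] otherwise. *)
Definition noisy_risk q B xi y :=
  (1 + xi) / 2 * `|B - y| `^ q + (1 - xi) / 2 * `|- B - y| `^ q.

Lemma exists_noisy_risk_min q B xi : 1 <= q -> 0 <= B ->
  exists2 y, - B <= y <= B &
    forall x, - B <= x <= B -> noisy_risk q B xi y <= noisy_risk q B xi x.
Proof.
move=> q1 B0; have [||y] := @EVT_min R (noisy_risk q B xi) (- B) B.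
- lra.
- apply: continuous_subspaceT => x.
  have c a : continuous (fun y => `|a - y| `^ q).
    move=> z; apply: (@continuous_comp _ _ _ (fun y => a - y) (fun y : R => `|y| `^ q)).
      by apply: cvgB => /=; [exact: cvg_cst|exact: cvg_id].
    exact: continuous_powR_norm.
  apply: cvgD; (apply: cvgM; [exact: cvg_cst|exact: c]).
by rewrite in_itv/= => yB miny; exists y => // x xB; apply: miny; rewrite in_itv.
Qed.

(** Serves as an upper bound on the minimal noisy risk. *)
Lemma noisy_risk_endpoint q B xi : 1 <= q -> 0 <= B ->
  noisy_risk q B xi B = (1 - xi) * 2 `^ (q - 1) * B `^ q.
Proof.
move=> q1 B0; rewrite /noisy_risk subrr normr0 powR0 ?gt_eqF ?(lt_le_trans _ q1)//.
have -> : `|- B - B| = 2 * B by rewrite -opprD normrN ger0_norm ?addr_ge0//; ring.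
by rewrite mulr0 add0r powRM// powRB ?pnatr_eq0 ?implybT// powRr1//; ring.
Qed.

Lemma noisy_risk0 q B xi : 0 <= B -> noisy_risk q B xi 0 = B `^ q.
Proof.
by move=> B0; rewrite /noisy_risk !subr0 normrN ger0_norm// -mulrDl; lra.
Qed.

End power_loss.

(** * Lower bounds on powers of [1 - x] *)

Lemma bernoulli_inequality (R : realFieldType) (x : R) n :
  0 <= x <= 1 -> 1 - n%:R * x <= (1 - x) ^+ n.
Proof.
move=> x01; elim: n => [|n IHn]; first by rewrite mul0r subr0 expr0.
rewrite exprS; apply: le_trans (ler_wpM2l _ IHn); last by lra.
by have := mulr_ge0 (ler0n R n) (sqr_ge0 x); rewrite -natr1; nra.
Qed.

(** Here [1 - w] is at least [1 - 1 / (n + 1)], the inverse of [1 + 1 / n], which is at most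
    [expR (1 / n)]. *)
Lemma onem_exp_ge_inve (R : realType) (w : R) n : (0 < n)%N ->
  w <= (n.+1%:R)^-1 -> expR (- 1) <= (1 - w) ^+ n.
Proof.
move=> n0 wn; have n0' : 0 < n%:R :> R by rewrite ltr0n.
have -> : - 1 = (- n%:R^-1) * n%:R :> R by rewrite mulNr mulVf ?gt_eqF.
rewrite expRM_natr; apply: lerXn2r; rewrite ?nnegrE ?expR_ge0//.
  by rewrite subr_ge0 (le_trans wn)// invf_le1 ?ler1n ?ltr0n.
apply: (@le_trans _ _ (1 + n%:R^-1)^-1).
  rewrite expRN lef_pV2 ?posrE ?expR_gt0 ?expR_ge1Dx//.
rewrite -natr1 in wn.
rewrite (_ : (1 + n%:R^-1)^-1 = 1 - (n%:R + 1)^-1) ?lerD2l ?lerN2//.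
by field; lra.
Qed.

Lemma sum_pair_bool (V : nmodType) (I : finType) (F : I * bool -> V) :
  \sum_j F j = \sum_i (F (i, true) + F (i, false)).
Proof.
rewrite (eq_bigr (fun j => F (j.1, j.2))) => [|[]//].
by rewrite -(pair_bigA _ (fun i b => F (i, b))); apply: eq_bigr => i _; rewrite big_bool.
Qed.

(** * The laws indexed by the hypercube *)

Section cube_law.
Context (R : realFieldType) (m : nat) (w xi : R).
Context (w0 : 0 <= w) (mw1 : m%:R * w <= 1) (xi01 : 0 <= xi <= 1).
Implicit Types (s : {ffun 'I_m -> bool}) (j : 'I_m.+1 * bool).

Let xi_ge0 : 0 <= xi. Proof. by case/andP: xi01. Qed.
Let onem_xi_ge0 : 0 <= 1 - xi. Proof. by rewrite subr_ge0; case/andP: xi01. Qed.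

(* Atom [(i, b)] stands for the observation [Y = B] or [Y = - B], according to
   [b], at the [i]-th point; point [0] is noiseless and carries no information,
   point [lift ord0 k] has mass [w] and noisy label [s k]. *)
Definition cube_law s j : R :=
  if unlift ord0 j.1 is Some k then
    w / 2 * (if j.2 == s k then 1 + xi else 1 - xi)
  else if j.2 then 1 - m%:R * w else 0.

Lemma cube_law_ge0 s j : 0 <= cube_law s j.
Proof.
rewrite /cube_law; case: unliftP => [k _|_]; last by case: ifP; rewrite ?subr_ge0.
by rewrite mulr_ge0 ?divr_ge0//; case: ifP => _ //; rewrite addr_ge0.
Qed.

Lemma sum_cube_law s (F : 'I_m.+1 * bool -> R) :
  \sum_j cube_law s j * F j = (1 - m%:R * w) * F (ord0, true) +
  w * \sum_k ((1 + xi) / 2 * F (lift ord0 k, s k) +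
              (1 - xi) / 2 * F (lift ord0 k, ~~ s k)).
Proof.
rewrite sum_pair_bool big_ord_recl /cube_law /= unlift_none mul0r addr0; congr (_ + _).
rewrite mulr_sumr; apply: eq_bigr => k _; rewrite liftK.
by case: (s k) => /=; ring.
Qed.

Lemma cube_law_sum1 s : \sum_j cube_law s j = 1.
Proof.
under eq_bigr do rewrite -[cube_law _ _]mulr1.
rewrite sum_cube_law; under eq_bigr do rewrite !mulr1 -mulrDl addrACA addrN addr0 divff//.
by rewrite sumr_const card_ord; ring.
Qed.

(* Lies below the laws of both [s] and [flip k s] for [t = 1 - xi], and below
   their geometric mean for [t = 1 - xi ^+ 2]. *)
Definition damped_law k t s j : R :=
  if j.1 == lift ord0 k then w / 2 * t else cube_law s j.

Lemma damped_law_ge0 k t s j : 0 <= t -> 0 <= damped_law k t s j.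
Proof.
move=> t0; rewrite /damped_law.
by case: ifP => _; rewrite ?cube_law_ge0// ?mulr_ge0 ?divr_ge0.
Qed.

(** Only the two atoms at [lift ord0 k] change; their joint mass goes from [w] to [w * t]. *)
Lemma damped_law_sum k t s : \sum_j damped_law k t s j = 1 - w * (1 - t).
Proof.
have -> : \sum_j damped_law k t s j =
    \sum_j cube_law s j * (j.1 != lift ord0 k)%:R +
    \sum_(j : 'I_m.+1 * bool) (if j.1 == lift ord0 k then w / 2 * t else 0).
  rewrite -big_split/=; apply: eq_bigr => j _; rewrite /damped_law.
  by case: eqP => _; rewrite (mulr0, mulr1) (add0r, addr0).
rewrite sum_cube_law/= mulr1.
under eq_bigr do
  rewrite (inj_eq (@lift_inj _ _)) -!mulrDl addrACA addrN addr0 divff// mul1r.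
rewrite sum_pair_bool (bigD1 (lift ord0 k))//= eqxx.
rewrite [X in _ + (_ + X)]big1 => [|i /negPf ->]; last first.
  by rewrite addr0.
rewrite (eq_bigr (fun l => 1 - (l == k)%:R)) => [|l _]; last first.
  by case: eqP => _; rewrite ?subrr ?subr0.
rewrite sumrB sumr_const card_ord (bigD1 k)//= eqxx big1 => [|l /negPf ->//].
by rewrite /=; field.
Qed.

Lemma flip_law_off k s j : j.1 != lift ord0 k -> cube_law (flip k s) j = cube_law s j.
Proof.
rewrite /cube_law; case: unliftP => // l -> /=.
by rewrite (inj_eq (@lift_inj _ _)) ffunE => /negPf ->.
Qed.

(** For [xi = 1] the bound is the probability that the [k]-th point is absent from the sample. *)
Lemma cube_law_min n k s : (1 - w * xi) ^+ n <=
  \sum_(z : n.-tuple _) Num.min (\prod_(j <- z) cube_law s j)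
                                (\prod_(j <- z) cube_law (flip k s) j).
Proof.
have le_law t j : damped_law k (1 - xi) t j <= cube_law t j.
  rewrite /damped_law; case: eqP => // jk; rewrite /cube_law jk liftK.
  rewrite ler_wpM2l ?divr_ge0//; case: ifP => _ //.
  by rewrite lerD2l (le_trans _ xi_ge0)// oppr_le0.
rewrite (_ : 1 - w * xi = \sum_j damped_law k (1 - xi) s j).
  apply: sum_min_prod_ge => j; first by rewrite damped_law_ge0.
    exact: le_law.
  apply: le_trans (le_law (flip k s) j).
  by rewrite /damped_law; case: ifPn => // jk; rewrite flip_law_off.
by rewrite damped_law_sum; ring.
Qed.

(** The bias enters at second order, against first order in [cube_law_min], which pays off for small
    [xi]. *)
Lemma cube_law_affinity n k s : (1 - w * xi ^+ 2) ^+ n / 2 - 8^-1 <=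
  \sum_(z : n.-tuple _) Num.min (\prod_(j <- z) cube_law s j)
                                (\prod_(j <- z) cube_law (flip k s) j).
Proof.
have t0 : 0 <= 1 - xi ^+ 2 by rewrite subr_ge0 expr_le1//; case/andP: xi01.
rewrite (_ : 1 - w * xi ^+ 2 = \sum_j damped_law k (1 - xi ^+ 2) s j).
  apply: sum_min_prod_ge_affinity => [j|j|j|j||];
    rewrite ?damped_law_ge0 ?cube_law_ge0 ?cube_law_sum1//.
  rewrite /damped_law; case: eqP => [jk|/eqP jk]; last by rewrite flip_law_off// expr2.
  rewrite /cube_law jk liftK ffunE eqxx addTb.
  have -> : w / 2 * (if j.2 == s k then 1 + xi else 1 - xi) *
            (w / 2 * (if j.2 == ~~ s k then 1 + xi else 1 - xi)) =
            (w / 2) ^+ 2 * (1 - xi ^+ 2).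
    by case: j.2; case: (s k) => /=; ring.
  (* The geometric mean has the square root of [1 - xi ^+ 2]; dropping the root only lowers it. *)
  rewrite exprMn ler_wpM2l ?sqr_ge0// expr2 ler_piMl//.
  by rewrite gerBl sqr_ge0.
by rewrite damped_law_sum; ring.
Qed.

End cube_law.

(** * Risks under finite laws *)

Lemma measurable_loss d (T : measurableType d) (R : realType) (B : {posnum R}) (q : R)
    (f g : T -> outcome B) : measurable_fun setT f -> measurable_fun setT g ->
  measurable_fun setT (fun t => loss q (f t) (g t)).
Proof.
move=> mf mg; apply: (measurableT_comp (measurable_powR q)).
apply: measurableT_comp => //; apply: measurable_funB.
  exact: (measurableT_comp (@measurable_outcome_val R B) mf).
exact: (measurableT_comp (@measurable_outcome_val R B) mg).
Qed.

Section finite_risk.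
Context disp (X : measurableType disp) (R : realType) (B : {posnum R}) (q : R).
Context (J : finType) (p : J -> R) (a : J -> X * outcome B).
Context (P : probability (X * outcome B)%type R).
Context (p0 : forall j, 0 <= p j).
Context (PE : forall f : X * outcome B -> \bar R,
  measurable_fun setT f -> (forall x, 0 <= f x)%E ->
  (\int[P]_x f x = \sum_j (p j)%:E * f (a j))%E).

Definition finite_risk (g : X -> outcome B) : R :=
  \sum_j p j * loss q (a j).2 (g (a j).1).

Lemma riskE (g : X -> outcome B) : measurable_fun setT g ->
  risk q P g = (finite_risk g)%:E.
Proof.
move=> mg; rewrite /risk unlock PE.
- by rewrite -sumEFin; apply: eq_bigr.
- apply/measurable_EFinP; apply: measurable_loss => //.
  exact: measurableT_comp.
- by move=> z; rewrite lee_fin powR_ge0.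
Qed.

Lemma expected_riskE n (ghat : n.-tuple (X * outcome B) -> X -> outcome B) :
  estimator ghat ->
  expected_risk q P ghat =
  (\sum_(z : n.-tuple J) \prod_(j <- z) p j * finite_risk (ghat (map_tuple a z)))%:E.
Proof.
move=> mghat.
have mx z : measurable_fun setT (ghat z).
  exact: (measurableT_comp mghat (pair1_measurable z)).
have mz x : measurable_fun setT (ghat ^~ x).
  exact: (measurableT_comp mghat (pair2_measurable x)).
rewrite /expected_risk (integral_product_law p0 PE).
- by rewrite -sumEFin; apply: eq_bigr => z _; rewrite riskE.
- under eq_fun do rewrite riskE//.
  apply/measurable_EFinP; apply: measurable_sum => j.
  by apply: measurable_funM => //; exact: measurable_loss.
- move=> z; rewrite riskE// lee_fin sumr_ge0// => j _.
  by rewrite mulr_ge0// powR_ge0.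
Qed.

End finite_risk.

(** * Outcomes serving as labels and as predictions *)

Section two_values.
Context (R : realType) (B : {posnum R}).

Definition sgnb (b : bool) : R := if b then 1 else -1.

Lemma signed_subproof (y : outcome B) b :
  - B%:num <= sgnb b * outcome_val y <= B%:num.
Proof.
have /andP[By yB] := outcome_val_itv y.
by case: b; rewrite /sgnb ?mul1r ?mulN1r ?By// lerN2 yB lerNl By.
Qed.

Definition signed y b : outcome B := outcome_of (signed_subproof y b).

Lemma signedE y b : outcome_val (signed y b) = sgnb b * outcome_val y.
Proof. by []. Qed.

Lemma shrunk_subproof k : - B%:num <= B%:num / k.+1%:R <= B%:num.
Proof.
have B0 : 0 <= B%:num / k.+1%:R by [].
rewrite ler_pdivrMr// ler_peMr ?ler1n//= andbT.
by rewrite (le_trans _ B0)// oppr_le0.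
Qed.

(** Distinct outcomes starting at [B], enough to tell any number of prediction functions apart at
    one point. *)
Definition shrunk k : outcome B := outcome_of (shrunk_subproof k).

Lemma shrunkE k : outcome_val (shrunk k) = B%:num / k.+1%:R.
Proof. by []. Qed.

Lemma shrunk_inj : injective shrunk.
Proof.
move=> k l /(congr1 (@outcome_val R B)); rewrite !shrunkE => /(mulfI (lt0r_neq0 (gt0 B))).
by move=> /invr_inj /eqP; rewrite eqr_nat eqSS => /eqP.
Qed.

(** By symmetry of the loss, flipping the bit amounts to changing the sign of the prediction. *)
Lemma noisy_risk_sgnb q xi b (v : outcome B) :
  (1 + xi) / 2 * loss q (signed (shrunk 0) b) v +
  (1 - xi) / 2 * loss q (signed (shrunk 0) (~~ b)) v =
  noisy_risk q B%:num xi (sgnb b * outcome_val v).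
Proof.
rewrite /loss /noisy_risk !signedE shrunkE divr1.
case: b; rewrite /sgnb /= !(mul1r, mulN1r) ?opprK//.
by congr (_ * _ `^ _ + _ * _ `^ _); rewrite -normrN opprD !opprK.
Qed.

End two_values.

(** The minimum over all [d] functions is at most the risk of the vertex [s] provided by [assouad],
    which is optimal under the law of [s]. *)
Lemma hypercube_lower_bound (R : realType) (B : {posnum R}) (d n : nat)
    (q w xi S : R) disp (X : measurableType disp) (m := trunc_log 2 d) :
  (0 < d)%N -> 1 <= q -> 0 <= w -> m%:R * w <= 1 -> 0 <= xi <= 1 -> 0 <= S ->
  (1 - xi) * 2 `^ (q - 1) < 1 ->
  (forall s k, S <= \sum_(z : n.-tuple _)
     Num.min (\prod_(j <- z) @cube_law R m w xi s j)
             (\prod_(j <- z) cube_law w xi (flip k s) j)) ->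
  has_points X m.+1 ->
  exists2 G : 'I_d -> {mfun X >-> outcome B}, injective G &
    forall ghat : n.-tuple (X * outcome B) -> X -> outcome B,
      estimator ghat ->
      exists P : probability (X * outcome B)%type R,
        ((m%:R * w * S * (1 - (1 - xi) * 2 `^ (q - 1)) * B%:num `^ q)%:E
         <= expected_risk q P ghat -
            \big[Order.min/+oo]_(j < d) risk q P (G j))%E.
Proof.
move=> d0 q1 w0 mw1 xi01 S0 gap aff [x sepx].
have [ystar ystarB ymin] := exists_noisy_risk_min xi q1 (ge0 B).
pose y : outcome B := outcome_of ystarB.
have phi_gap : noisy_risk q B%:num xi ystar <=
    (1 - xi) * 2 `^ (q - 1) * B%:num `^ q.
  by rewrite -noisy_risk_endpoint// ymin// lexx andbT (le_trans _ (ge0 B))// oppr_le0 ge0.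
have Bq0 : 0 < B%:num `^ q by rewrite powR_gt0.
(* At [0] the noisy risk is [B] to the power [q], too large by [gap]. A nonzero [ystar] makes
   distinct vertices distinct functions. *)
have ystar0 : ystar != 0.
  by apply: contraTneq phi_gap => ->; rewrite noisy_risk0// -ltNge gtr_pMl//.
pose cube := enum {ffun 'I_m -> bool}.
have size_cube : size cube = (2 ^ m)%N by rewrite -cardE card_ffun card_bool card_ord.
pose vert i := nth [ffun=> true] cube i.
(* Truncated subtraction: [G i] with [i < 2 ^ m] is a vertex, worth [B] at [x ord0];
   the remaining indices only matter for the cardinal and are told apart there. *)
pose v (i : 'I_d) (l : 'I_m.+1) : outcome B :=
  if unlift ord0 l is Some k then signed y (vert i k) else shrunk B (i.+1 - 2 ^ m).
have /choice[G Gv] i := measurable_interpolation (v i) sepx.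
exists G.
  move=> i j eqG; have eqv l : v i l = v j l by rewrite -!Gv eqG.
  have := eqv ord0; rewrite /v unlift_none => /shrunk_inj eqt.
  (* An index from [2 ^ m] on is recovered from its positive difference; indices below it all give
     [0] and are separated by their vertices. *)
  have [jm|jm] := leqP (2 ^ m) j.
    by apply: val_inj => /=; move: eqt jm; clear; lia.
  have im : (i < 2 ^ m)%N by move: eqt jm; clear; lia.
  have eqvert : vert i = vert j.
    apply/ffunP => k; have := eqv (lift ord0 k); rewrite /v liftK.
    move=> /(congr1 (@outcome_val R B)); rewrite !signedE => /(mulIf ystar0).
    by case: (vert i k) (vert j k) => -[]//; rewrite /sgnb; lra.
  apply/val_inj/eqP.
  by rewrite -(@nth_uniq _ [ffun=> true] cube) ?enum_uniq ?size_cube//; apply/eqP.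
move=> ghat mghat.
pose a (j : 'I_m.+1 * bool) := (x j.1, signed (shrunk B 0) j.2).
pose law s := @cube_law R m w xi s.
have law0 s j : 0 <= law s j by exact: cube_law_ge0.
have /choice[P PE] s := exists_finite_law a (law0 s) (cube_law_sum1 w xi s).
pose phi := noisy_risk q B%:num xi.
have frisk s g : finite_risk q (law s) a g =
    (1 - m%:R * w) * loss q (signed (shrunk B 0) true) (g (x ord0)) +
    w * \sum_k phi (sgnb R (s k) * outcome_val (g (x (lift ord0 k)))).
  rewrite /finite_risk sum_cube_law/=; congr (_ + _ * _).
  by apply: eq_bigr => k _; rewrite noisy_risk_sgnb.
pose e (z : n.-tuple ('I_m.+1 * bool)) (k : 'I_m) b : R :=
  phi (sgnb R b * outcome_val (ghat (map_tuple a z) (x (lift ord0 k)))) - phi ystar.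
pose c := B%:num `^ q - phi ystar.
have c_gap : (1 - (1 - xi) * 2 `^ (q - 1)) * B%:num `^ q <= c.
  by rewrite mulrBl mul1r lerD2l lerN2.
have c0 : 0 <= c by rewrite (le_trans _ c_gap)// mulr_ge0// ?ltW// subr_gt0.
have e0 z k b : 0 <= e z k b.
  by rewrite subr_ge0 ymin// signed_subproof.
(* Summing over both bits cancels [xi] and leaves the two losses of [powR_midpoint]. *)
have e2 z k : 2 * c <= e z k true + e z k false.
  rewrite /e /sgnb mul1r mulN1r; set u := outcome_val _.
  have := powR_midpoint q1 (outcome_val_itv (ghat (map_tuple a z) (x (lift ord0 k)))).
  rewrite -/u /c /phi /noisy_risk opprK.
  rewrite (_ : `|B%:num + u| = `|- B%:num - u|); last by rewrite -normrN opprD.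
  rewrite (_ : `|- B%:num + u| = `|B%:num - u|); last by rewrite -normrN opprD opprK.
  by lra.
have pi0 s (z : n.-tuple ('I_m.+1 * bool)) : 0 <= \prod_(j <- z) law s j.
  by rewrite prodr_ge0.
have [s Hs] := assouad pi0 c0 e0 e2 aff.
exists (P s); have lt_s : (index s cube < d)%N.
  apply: (@leq_trans (2 ^ m)); last exact: trunc_logP.
  by rewrite -size_cube index_mem mem_enum.
have riskG : risk q (P s) (G (Ordinal lt_s)) = (w * (m%:R * phi ystar))%:E.
  rewrite (riskE q (PE s))//; congr _%:E.
  rewrite frisk !Gv /v unlift_none /=.
  have -> : ((index s cube).+1 - 2 ^ m = 0)%N.
    by apply/eqP; rewrite subn_eq0 -size_cube index_mem mem_enum.
  rewrite /loss signedE shrunkE divr1 mul1r subrr normr0.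
  rewrite powR0 ?gt_eqF ?(lt_le_trans _ q1)// mulr0 add0r.
  congr (_ * _); rewrite (eq_bigr (fun=> phi ystar)) => [|k _].
    by rewrite sumr_const card_ord mulr_natl.
  rewrite Gv /v liftK signedE /vert nth_index ?mem_enum// -[outcome_val y]/ystar.
  by congr phi; case: (s k); rewrite /sgnb; lra.
rewrite (expected_riskE q (law0 s) (PE s))//.
apply: le_trans (leeB (lexx _) (bigmin_le _ (Ordinal lt_s) _)).
rewrite riskG -EFinB lee_fin lerBrDr.
(* The nonnegative loss at the noiseless point is dropped; the risk of the vertex enters the sum
   because the sample law has mass [1]. *)
apply: (@le_trans _ _ (\sum_(z : n.-tuple ('I_m.+1 * bool))
    \prod_(j <- z) law s j * (w * \sum_k e z k (s k) + w * (m%:R * phi ystar)))).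
  under [leRHS]eq_bigr do rewrite mulrDr.
  rewrite big_split/= -mulr_suml sum_prod_tuple /law cube_law_sum1 expr1n mul1r lerD2r.
  under eq_bigr do rewrite mulrCA.
  rewrite -mulr_sumr (le_trans _ (ler_wpM2l w0 Hs))//.
  rewrite -mulrA (le_trans (ler_wpM2l _ c_gap)) ?mulr_ge0//; lra.
apply: ler_sum => z _; rewrite ler_wpM2l// frisk -mulrDr.
rewrite -[leLHS]add0r lerD//; first by rewrite mulr_ge0 ?subr_ge0 ?powR_ge0.
by rewrite ler_wpM2l// /e sumrB sumr_const card_ord mulr_natl subrK.
Qed.

(** * Choice of the parameters *)

Lemma expRN1_ge4 (R : realType) : 4^-1 <= expR (- 1) :> R.
Proof.
have -> : - 1 = (- 2^-1) * 2%:R :> R by rewrite mulNr mulVf.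
rewrite expRM_natr (_ : 4^-1 = 2^-1 ^+ 2 :> R); last by field.
apply: lerXn2r; rewrite ?nnegrE ?expR_ge0//.
by apply: le_trans (expR_ge1Dx _); lra.
Qed.

Theorem theorem8p12 (R : realType) (B : {posnum R}) (d n : nat) (q : R)
    (disp : measure_display) (X : measurableType disp)
    (hd : (1 <= d)%N) (hn : (1 <= n)%N)
    (hq : 1 + Num.sqrt
            (Num.min ((trunc_log 2 d)%:R / (4 * n%:R)) 1) < q)
    (hX : has_points X (trunc_log 2 (2 * d)%N)) :
  exists2 G : 'I_d -> {mfun X >-> outcome B}, injective G &
    forall ghat : n.-tuple (X * outcome B) -> X -> outcome B,
      estimator ghat ->
      exists P : probability (X * outcome B)%type R,
        (((Num.max (q / (90 * (q - 1))) (expR (-1)) * B%:num `^ q *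
           Num.min ((trunc_log 2 d)%:R / (n%:R + 1)) 1)%:E
         <= expected_risk q P ghat -
            \big[Order.min/+oo]_(j < d) risk q P (G j))%E).
Proof.
(* The number of points becomes [m.+1]: those of the cube and the noiseless one. *)
rewrite trunc_logMp// in hX.
set m := trunc_log 2 d in hq hX *.
have q1 : 1 < q by apply: le_lt_trans hq; rewrite lerDl sqrtr_ge0.
have Bq0 : 0 <= B%:num `^ q := powR_ge0 _ _.
have n0 : 0 < n%:R :> R by rewrite ltr0n.
have weaken (L M : R) : M <= L ->
    (exists2 G : 'I_d -> {mfun X >-> outcome B}, injective G &
      forall ghat : n.-tuple (X * outcome B) -> X -> outcome B, estimator ghat ->
      exists P : probability (X * outcome B)%type R,
        (L%:E <= expected_risk q P ghat -
           \big[Order.min/+oo]_(j < d) risk q P (G j))%E) ->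
    exists2 G : 'I_d -> {mfun X >-> outcome B}, injective G &
      forall ghat : n.-tuple (X * outcome B) -> X -> outcome B, estimator ghat ->
      exists P : probability (X * outcome B)%type R,
        (M%:E <= expected_risk q P ghat -
           \big[Order.min/+oo]_(j < d) risk q P (G j))%E.
  move=> ML [G injG low]; exists G => // ghat /low[P HP]; exists P.
  by apply: le_trans HP; rewrite lee_fin.
have [small|large] := leP (q / (90 * (q - 1))) (expR (-1)).
(* The largest [w] with both [m * w <= 1], for a law to exist, and [w <= 1 / (n + 1)], for the
   overlap to be at least [expR (-1)]. *)
- pose w : R := (maxn n.+1 m)%:R^-1.
  have w_gt0 : 0 < w by rewrite invr_gt0 ltr0n leq_max.
  have mw : m%:R * w = Num.min (m%:R / (n%:R + 1)) 1.
    rewrite /w natr1; have [nm|mn] := leqP n.+1 m.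
      rewrite divff ?pnatr_eq0 -?lt0n ?(leq_trans _ nm)//.
      by rewrite min_r// ler_pdivlMr ?ltr0n// mul1r ler_nat.
    rewrite min_l// ler_pdivrMr ?ltr0n// mul1r ler_nat.
    exact: ltnW.
  apply: weaken; last apply: (@hypercube_lower_bound R B d n q w 1 (expR (-1)) disp X hd
    (ltW q1) (ltW w_gt0) _ _ (expR_ge0 _) _ _ hX).
  + by rewrite subrr mul0r subr0 mulr1 -/m mw mulrC mulrA.
  + by rewrite -/m mw ge_min lexx orbT.
  + by rewrite ler01 lexx.
  + by rewrite subrr mul0r.
  + move=> s k; apply: le_trans (cube_law_min _ _ _ n k s); last first.
    * by rewrite ler01 lexx.
    * by rewrite -/m mw ge_min lexx orbT.
    * exact: ltW.
    rewrite mulr1 onem_exp_ge_inve// lef_pV2 ?posrE ?ltr0n ?leq_max//.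
    by rewrite ler_nat leq_max leqnn.
- pose eps := q - 1.
  have eps0 : 0 < eps by rewrite subr_gt0.
  have eps_small : 43 * eps < 2.
    have := le_lt_trans (expRN1_ge4 R) large.
    by rewrite ltr_pdivlMr ?mulr_gt0// /eps; lra.
  have m_small : m%:R / (4 * n%:R) < eps ^+ 2.
    have hsqrt : Num.sqrt (Num.min (m%:R / (4 * n%:R)) 1) < eps.
      by rewrite ltrBrDl.
    have min0 : 0 <= Num.min (m%:R / (4 * n%:R)) 1 :> R.
      by rewrite le_min ler01 divr_ge0 ?mulr_ge0.
    have : Num.min (m%:R / (4 * n%:R)) 1 < eps ^+ 2.
      by rewrite -[ltLHS](sqr_sqrtr min0) ltrXn2r.
    (* As [eps < 1], the argument [1] of the minimum is not below [eps ^+ 2]. *)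
    rewrite gt_min => /orP[//|]; rewrite ltNge expr_le1 ?(ltW eps0)//; lra.
  pose w : R := (4 * n%:R * eps ^+ 2)^-1.
  have w0 : 0 <= w by rewrite invr_ge0 mulr_ge0 ?sqr_ge0// mulr_ge0.
  pose xi : R := 7 / 5 * eps.
  have xi01 : 0 <= xi <= 1 by rewrite /xi; lra.
  have mw1 : m%:R * w <= 1.
    rewrite /w ler_pdivrMr ?mul1r ?mulr_gt0 ?exprn_gt0//.
    by move: m_small; rewrite ltr_pdivrMr ?mulr_gt0// mulrC => /ltW.
  have nwxi : n%:R * (w * xi ^+ 2) = 49 / 100.
    by rewrite /w /xi; field; lra.
  have pow2 : 2 `^ (q - 1) <= 1 + eps.
    by apply: powR2_le1D; rewrite /eps in eps0 eps_small *; lra.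
  (* With [pow2] the product is at most [1 - 2 / 5 * eps - 7 / 5 * eps ^+ 2]. *)
  have gap : (1 - xi) * 2 `^ (q - 1) <= 1 - 2 / 5 * eps.
    apply: le_trans (ler_wpM2l _ pow2) _; first by lra.
    by rewrite /xi; have := sqr_ge0 eps; lra.
  (* The overlap [13 / 100] is [(1 - 49 / 100) / 2 - 1 / 8], from the affinity bound and Bernoulli's
     inequality. *)
  apply: weaken; last apply: (@hypercube_lower_bound R B d n q w xi (13 / 100) disp X hd
    (ltW q1) w0 mw1 xi01 _ _ _ hX).
  + rewrite -/m -/eps mulrAC ler_wpM2r//.
    apply: (@le_trans _ _ (q / 90 / eps * (m%:R / n%:R))).
      rewrite invfM mulrA ler_wpM2l ?divr_ge0 ?(ltW eps0) ?(le_trans ler01 (ltW q1))//.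
      rewrite ge_min; apply/orP; left.
      by rewrite ler_wpM2l// lef_pV2 ?posrE ?addr_gt0// lerDl.
    apply: (@le_trans _ _ (m%:R * w * (13 / 100) * (2 / 5 * eps))).
      rewrite (_ : m%:R * w * (13 / 100) * (2 / 5 * eps) =
                   13 / 1000 / eps * (m%:R / n%:R)); last first.
        by rewrite /w; field; rewrite !gt_eqF.
      rewrite ler_wpM2r ?divr_ge0// ler_wpM2r ?invr_ge0 ?(ltW eps0)//.
      (* This asks for [q <= 117 / 100], while [eps_small] gives [q < 45 / 43]. *)
      by move: eps_small; rewrite /eps; lra.
    by rewrite ler_wpM2l ?mulr_ge0// lerBrDl -lerBrDr.
  + lra.
  + by apply: le_lt_trans gap _; lra.
  + move=> s k; apply: le_trans (cube_law_affinity w0 mw1 xi01 n k s).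
    have wxi1 : 0 <= w * xi ^+ 2 <= 1.
      rewrite mulr_ge0 ?sqr_ge0//=.
      rewrite -(ler_pM2l n0) nwxi mulr1 (@le_trans _ _ 1) ?ler1n//; lra.
    have := bernoulli_inequality n wxi1; rewrite nwxi; lra.
Qed.
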